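(* Let $f=(f_1,\dots,f_m)\colon\mathbb{R}^n\to\mathbb{R}^m$ and $g\colon\mathbb{R}^n\to Y$ be continuously Fréchet differentiable on $\mathbb{R}^n$, where $Y$ is a Banach space, let $\Theta\subset Y$ be a closed convex cone, and let $\mathcal{F}=\{x\in\mathbb{R}^n : g(x)\in-\Theta\}$. If $\bar x\in\mathcal{F}$ is a local weak efficient solution of the problem of minimizing $f$ over $\mathcal{F}$ with respect to $\mathbb{R}^m_+$, then $\bar x$ satisfies the AKKT condition.
   Context: $\mathbb{R}^m_+$ is the nonnegative orthant of $\mathbb{R}^m$; $m,n\ge 1$; $\mathbb{R}^n$ has the Euclidean norm and usual scalar product (identified with its dual). $Y^*$ is the dual of $Y$, $\langle\cdot,\cdot\rangle$ is the canonical pairing, and $\Theta_+:=\{\mu\in Y^* : \langle\mu,\theta\rangle\ge 0\ \ \forall\theta\in\Theta\}$. $\nabla f_i(x)$ is the gradient of $f_i$, $\nabla g(x)\colon\mathbb{R}^n\to Y$ is the derivative of $g$ at $x$, and $\nabla g(x)^*\colon Y^*\to\mathbb{R}^n$ is its adjoint. A point $\bar x\in\mathcal{F}$ is a local weak efficient solution if there is a neighborhood $U$ of $\bar x$ such that no $x\in U\cap\mathcal{F}$ satisfies $f_i(x)<f_i(\bar x)$ for all $i=1,\dots,m$. A point $\bar x\in\mathcal{F}$ satisfies the AKKT (approximate Karush--Kuhn--Tucker) condition if there exist $\lambda\in\mathbb{R}^m_+$ with $\sum_{i=1}^m\lambda_i=1$ and sequences $\{x^k\}\subset\mathbb{R}^n$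 (not required to be feasible) and $\{\mu^k\}\subset\Theta_+$ such that, as $k\to\infty$: $x^k\to\bar x$; $\nabla g(x^k)^*\mu^k+\sum_{i=1}^m\lambda_i\nabla f_i(\bar x)\to 0$; and $\langle\mu^k,g(x^k)\rangle\to 0$. *)

(* Defs.v *)
From HB Require Import structures.
From mathcomp Require Import all_boot all_order all_algebra.
From mathcomp Require Import all_classical all_reals all_analysis.

Set Implicit Arguments.
Unset Strict Implicit.
Unset Printing Implicit Defensive.

Import Order.TTheory GRing.Theory Num.Theory.
Import numFieldNormedType.Exports.

Local Open Scope classical_set_scope.
Local Open Scope ring_scope.

(* R^n is 'rV[R]_n. The library equips it with the sup norm; being equivalent
   to the Euclidean one, it yields the same neighborhoods, limits,
   (Frechet) derivatives and C^1 maps. The Euclidean structure matters only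
   through the scalar product, which identifies R^n with its dual. *)
Definition dotv (R : realType) (n : nat) (u v : 'rV[R]_n) : R :=
  \sum_(j < n) u 0 j * v 0 j.

Definition riesz (R : realType) (n : nat) (phi : 'rV[R]_n -> R) : 'rV[R]_n :=
  \row_j phi (delta_mx 0 j).

Lemma rieszP (R : realType) (n : nat) (phi : {linear 'rV[R]_n -> R^o})
  (v : 'rV[R]_n) : (forall h, dotv v h = phi h) <-> v = riesz phi.
Proof.
split=> [vphi|-> h].
  apply/rowP => j; rewrite mxE -vphi /dotv (bigD1 j)//= mxE !eqxx mulr1.
  by rewrite big1 ?addr0// => i ij; rewrite mxE (negbTE ij) andbF mulr0.
rewrite {2}[h]row_sum_delta linear_sum /dotv; apply: eq_bigr => j _.
by rewrite mxE linearZ /= mulrC.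
Qed.

Definition gradient (R : realType) (n : nat) (phi : 'rV[R]_n -> R^o)
  (x : 'rV[R]_n) : 'rV[R]_n := riesz ('d phi x).

Definition adjoint (R : realType) (n : nat) (Y : normedModType R)
  (L : {linear 'rV[R]_n -> Y}) (mu : {linear Y -> R^o}) : 'rV[R]_n :=
  riesz (mu \o L).

Lemma gradientP (R : realType) (n : nat) (phi : 'rV[R]_n -> R^o)
  (x h : 'rV[R]_n) : dotv (gradient phi x) h = 'd phi x h.
Proof. by apply: (proj2 (rieszP _ _)). Qed.

Lemma adjointP (R : realType) (n : nat) (Y : normedModType R)
  (L : {linear 'rV[R]_n -> Y}) (mu : {linear Y -> R^o}) (h : 'rV[R]_n) :
  dotv (adjoint L mu) h = mu (L h).
Proof. by apply: (proj2 (rieszP (mu \o L) _)). Qed.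

(* The second clause is continuity of x |-> 'd f x for the operator norm. *)
Definition continuously_differentiable (R : realType) (V W : normedModType R)
    (f : V -> W) : Prop :=
  (forall x, differentiable f x) /\
  (forall x (e : R), 0 < e ->
     \forall y \near x, forall h, `|'d f y h - 'd f x h| <= e * `|h|).

Definition cone (R : realType) (Y : lmodType R) (C : set Y) : Prop :=
  forall (t : R) y, 0 <= t -> C y -> C (t *: y).

(* Elements of the topological dual Y^* are the continuous linear forms;
   the pairing <mu, y> is the application mu y. *)
Definition dual_cone (R : realType) (Y : normedModType R) (Theta : set Y) :
    set {linear Y -> R^o} :=
  [set mu : {linear Y -> R^o} | continuous mu /\
     forall theta, Theta theta -> 0 <= mu theta].

Definition feasible (R : realType) (n : nat) (Y : normedModType R)
    (g : 'rV[R]_n -> Y) (Theta : set Y) : set 'rV[R]_n :=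
  [set x | [set - theta | theta in Theta] (g x)].

Definition local_weak_efficient (R : realType) (n m : nat)
    (f : 'rV[R]_n -> 'rV[R]_m) (F : set 'rV[R]_n) (xbar : 'rV[R]_n) : Prop :=
  F xbar /\
  exists U, nbhs xbar U /\
    ~ exists x, (U `&` F) x /\ forall i, f x 0 i < f xbar 0 i.

Definition AKKT (R : realType) (n m : nat) (Y : normedModType R)
    (f : 'rV[R]_n -> 'rV[R]_m) (g : 'rV[R]_n -> Y) (Theta : set Y)
    (xbar : 'rV[R]_n) : Prop :=
  feasible g Theta xbar /\
  exists (lambda : 'rV[R]_m) (x : nat -> 'rV[R]_n)
         (mu : nat -> {linear Y -> R^o}),
    [/\ (forall i, 0 <= lambda 0 i) /\ \sum_(i < m) lambda 0 i = 1,
        forall k, dual_cone Theta (mu k),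
        x k @[k --> \oo] --> xbar,
        (adjoint ('d g (x k)) (mu k)
           + \sum_(i < m) lambda 0 i *: gradient (fun z => f z 0 i) xbar)
          @[k --> \oo] --> (0 : 'rV[R]_n) &
        mu k (g (x k)) @[k --> \oo] --> (0 : R^o)].

(* Main.v *)
(* Penalize the constraint exactly: minimize
     max_i (f_i x - f_i xb) + |x - xb|^2 + k d(g x, - Theta)
   over a small closed ball around xb. As k grows, minimizers x_k accumulate
   at xb by local weak efficiency, and k d(g x_k, - Theta) becomes small. The
   function P(a, y) = max_i a_i + k d(y, - Theta) is sublinear, so the first
   order condition at x_k and the Hahn-Banach theorem give a linear xi <= P,
   xi = (lambda, mu), equal to P at (f x_k - f xb, g x_k) and to the derivative
   of - |. - xb|^2 along the derivative of (f, g). Being below P puts lambda in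
   the simplex and mu in the dual cone, while the equality gives
   <mu, g x_k> = k d(g x_k, - Theta). Finally let lambda converge along a
   subsequence.
   Hahn-Banach itself comes from Zorn's lemma: a minimal sublinear function is
   linear. *)
Require Import Defs.
From HB Require Import structures.
From mathcomp Require Import all_boot all_order all_algebra.
From mathcomp Require Import all_classical all_reals all_analysis.
From mathcomp Require Import ring lra.

Set Implicit Arguments.
Unset Strict Implicit.
Unset Printing Implicit Defensive.

Import Order.TTheory GRing.Theory Num.Theory.
Import numFieldNormedType.Exports.

Local Open Scope classical_set_scope.
Local Open Scope ring_scope.

(** * Sublinear functions and a Hahn-Banach theorem with side constraints *)

Definition sublinear (R : realType) (V : lmodType R) (p : V -> R) : Prop :=
  (forall x y, p (x + y) <= p x + p y) /\
  (forall t x, 0 <= t -> p (t *: x) <= t * p x).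

Section Sublinear.
Context {R : realType} {V : lmodType R}.
Implicit Types (p q : V -> R) (x y a : V) (t : R).

Lemma sublinear0 p : sublinear p -> p 0 = 0.
Proof.
move=> [pD pZ]; apply/eqP; rewrite eq_le; apply/andP; split.
  by have := pZ 0 0 (lexx 0); rewrite scale0r mul0r.
by have := pD 0 0; rewrite addr0 lerDl.
Qed.

Lemma sublinearN_ge p x : sublinear p -> - p (- x) <= p x.
Proof.
move=> sp; rewrite lerNl -subr_ge0 opprK -(sublinear0 sp) -(addNr x).
exact: sp.1.
Qed.

Lemma sublinearB_le p x y : sublinear p -> p x - p y <= p (x - y).
Proof. by move=> sp; rewrite lerBlDr -{1}(subrK y x) sp.1. Qed.

(** The opposite inequality is the defining one applied to [t^-1] and [t *: x]. *)
Lemma sublinearZ p t x : sublinear p -> 0 <= t -> p (t *: x) = t * p x.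
Proof.
move=> sp; rewrite le_eqVlt => /predU1P[<-|t0].
  by rewrite scale0r mul0r sublinear0.
apply/eqP; rewrite eq_le (sp.2 _ _ (ltW t0))/= -ler_pdivlMl//.
rewrite -{1}(scale1r x) -(mulVf (lt0r_neq0 t0)) -scalerA sp.2//.
by rewrite invr_ge0 ltW.
Qed.

(** Oddness turns subadditivity at [- x], [- y] into superadditivity and carries homogeneity over to
    negative scalars. *)
Lemma odd_sublinear_linear p : sublinear p -> (forall x, p (- x) = - p x) ->
  exists xi : {linear V -> R^o}, p = xi.
Proof.
move=> sp pN.
have pD x y : p (x + y) = p x + p y.
  apply/eqP; rewrite eq_le sp.1/= -lerN2 -pN !opprD -!pN.
  exact: sp.1.
have pZ t x : p (t *: x) = t * p x.
  have [t0|/ltW t0] := leP 0 t; first exact: sublinearZ.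
  by rewrite -{1}(opprK t) scaleNr pN sublinearZ ?oppr_ge0// mulNr opprK.
have lp : linear (p : V -> R^o) by move=> t x y; rewrite pD pZ.
pose f : {linear V -> R^o} := HB.pack (p : V -> R^o)
  (GRing.isLinear.Build R V R^o _ (p : V -> R^o) lp).
by exists f.
Qed.

(* For p the norm and C = Theta x {0} this is the distance to - Theta; for
   general C it is the sublinear function that forces c <= xi a on C for every
   linear minorant xi. *)
Definition inf_shift p (C : set (V * R)) x : R :=
  inf [set p (x + ac.1) - ac.2 | ac in C].

(** A pair (a, c) in [C] stands for the constraint c <= xi a on a linear xi; the last clause makes
    these constraints compatible with xi <= p. *)
Definition convex_cone_below p (C : set (V * R)) : Prop :=
  [/\ C (0, 0), forall ac bd, C ac -> C bd -> C (ac.1 + bd.1, ac.2 + bd.2),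
      forall t ac, 0 <= t -> C ac -> C (t *: ac.1, t * ac.2) &
      forall ac, C ac -> ac.2 <= p ac.1].

Lemma inf_shift_le p C x ac : sublinear p -> convex_cone_below p C -> C ac ->
  inf_shift p C x <= p (x + ac.1) - ac.2.
Proof.
move=> sp [_ _ _ Cp] Cac; apply: ge_inf; last by exists ac.
(* Since c <= p a <= p (x + a) + p (- x), the values are bounded below and the infimum is a genuine
   one. *)
exists (- p (- x)) => _ [bd Cbd <-].
rewrite lerBrDl -lerBrDr opprK (le_trans (Cp _ Cbd))//.
by rewrite -{1}(addrK x bd.1) (addrC bd.1) sp.1.
Qed.

Lemma inf_shift_ge p C x t : convex_cone_below p C ->
  (forall ac, C ac -> t <= p (x + ac.1) - ac.2) -> t <= inf_shift p C x.
Proof.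
move=> [C0 _ _ _] tC; apply: lb_le_inf => [|_ [ac Cac <-]]; last exact: tC.
by exists (p (x + 0) - 0); exists (0, 0).
Qed.

Lemma inf_shift_le_self p C x : sublinear p -> convex_cone_below p C ->
  inf_shift p C x <= p x.
Proof.
move=> sp Cp; have [C0 _ _ _] := Cp.
by apply: le_trans (inf_shift_le x sp Cp C0) _; rewrite /= addr0 subr0.
Qed.

(** As [C] is stable under sums, pairs tried at x and at y add up to a pair for x + y; positive
    scaling acts on [C] likewise. *)
Lemma sublinear_inf_shift p C : sublinear p -> convex_cone_below p C ->
  sublinear (inf_shift p C).
Proof.
move=> sp Cp; have [C0 CD CZ _] := Cp; split=> [x y|t x t0].
  rewrite -lerBlDr; apply: inf_shift_ge => // ac Cac.
  rewrite lerBlDl -lerBlDr; apply: inf_shift_ge => // bd Cbd.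
  have := inf_shift_le (x + y) sp Cp (CD _ _ Cac Cbd).
  have := sp.1 (x + ac.1) (y + bd.1); rewrite addrACA /=; lra.
move: t0; rewrite le_eqVlt => /predU1P[<-|t0].
  by rewrite scale0r mul0r (le_trans (inf_shift_le_self _ sp Cp))// sublinear0.
rewrite -ler_pdivrMl//; apply: inf_shift_ge => // ac Cac.
rewrite ler_pdivrMl//.
apply: le_trans (inf_shift_le _ sp Cp (CZ t _ (ltW t0) Cac)) _.
by rewrite /= -scalerDr mulrBr lerD2r sp.2// ltW.
Qed.

Lemma inf_shiftN_le p C ac : sublinear p -> convex_cone_below p C -> C ac ->
  inf_shift p C (- ac.1) <= - ac.2.
Proof.
move=> sp Cp Cac; apply: le_trans (inf_shift_le _ sp Cp Cac) _.
by rewrite addNr sublinear0// add0r.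
Qed.

(** Shifting p along the ray spanned by (x, p x) gives a sublinear function below p, hence p itself
    by minimality; its value at - x is at most - p x by construction. *)
Lemma minimal_sublinear_odd p : sublinear p ->
  (forall q, sublinear q -> (forall x, q x <= p x) -> q = p) ->
  forall x, p (- x) = - p x.
Proof.
move=> sp pmin x.
pose C := [set (t *: x, t * p x) | t in [set t : R | 0 <= t]].
have Cp : convex_cone_below p C.
  split.
  - by exists 0 => /=; rewrite ?scale0r ?mul0r.
  - move=> _ _ [s s0 <-] [t t0 <-] /=; exists (s + t); first exact: addr_ge0.
    by rewrite scalerDl mulrDl.
  - move=> s _ s0 [t t0 <-] /=; exists (s * t); first exact: mulr_ge0.
    by rewrite scalerA mulrA.
  - by move=> _ [t t0 <-] /=; rewrite sublinearZ.
have Cx : C (x, p x) by exists 1; rewrite /= ?scale1r ?mul1r.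
have pE := pmin _ (sublinear_inf_shift sp Cp)
  (fun y => inf_shift_le_self y sp Cp).
apply/eqP; rewrite eq_le; apply/andP; split.
  by have := inf_shiftN_le sp Cp Cx; rewrite pE.
by have := sublinearN_ge (- x) sp; rewrite opprK.
Qed.

(** Zorn's lemma for the reversed pointwise order on sublinear functions below p: a maximal element
    is a minimal sublinear function, so it is odd and therefore linear. A nonempty chain is bounded
    by its pointwise infimum. *)
Lemma sublinear_linear_minorant p : sublinear p ->
  exists xi : {linear V -> R^o}, forall x, xi x <= p x.
Proof.
move=> sp.
pose T := {q : V -> R | sublinear q /\ forall x, q x <= p x}.
pose le_rev (q r : T) := `[< forall x, sval r x <= sval q x >].
have [|||A tA|[q [sq qp]] qmin] := @Zorn T le_rev.
- by move=> q; apply/asboolP.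
- move=> q r s /asboolP qr /asboolP rs; apply/asboolP => x.
  exact: le_trans (rs x) (qr x).
- move=> [q qP] [r rP] /asboolP/= qr /asboolP/= rq.
  apply: eq_exist; apply/funext => x.
  by apply/eqP; rewrite eq_le qr rq.
(* The empty chain is bounded by p itself. *)
- have [[q0 Aq0]|A0] := pselect (A !=set0); last first.
    exists (exist _ p (conj sp (fun x => lexx (p x)))) => s As.
    by exfalso; apply: A0; exists s.
  pose E x := [set sval q x | q in A].
  have Elb x : has_lbound (E x).
    exists (- p (- x)) => _ [r Ar <-].
    apply: le_trans (sublinearN_ge _ (svalP r).1).
    by rewrite lerN2 (svalP r).2.
  have Ele x (q : T) : A q -> inf (E x) <= sval q x.
    by move=> Aq; apply: ge_inf => //; exists q.
  have Ege x t : (forall q : T, A q -> t <= sval q x) -> t <= inf (E x).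
    move=> tq; apply: lb_le_inf; first by exists (sval q0 x), q0.
    by move=> _ [q Aq <-]; exact: tq.
  have sE : sublinear (fun x => inf (E x)).
    split=> [x y|t x].
      rewrite -lerBlDr; apply: (Ege) => q Aq.
      rewrite lerBlDl -lerBlDr; apply: (Ege) => r Ar.
      (* q is tried at x and r at y; in a chain one of them lies below the other, and that one
         bounds the infimum at x + y. *)
      rewrite lerBlDr; case: (tA q r Aq Ar) => /asboolP qr.
        apply: le_trans (Ele _ _ Ar) _.
        by rewrite (le_trans ((svalP r).1.1 _ _))// addrC lerD2l.
      apply: le_trans (Ele _ _ Aq) _.
      by rewrite (le_trans ((svalP q).1.1 _ _))// addrC lerD2r.
    rewrite le_eqVlt => /predU1P[<-|t0].
      rewrite scale0r mul0r; apply: le_trans (Ele _ _ Aq0) _.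
      by rewrite (sublinear0 (svalP q0).1).
    rewrite -ler_pdivrMl//; apply: (Ege) => q Aq; rewrite ler_pdivrMl//.
    by apply: le_trans (Ele _ _ Aq) _; apply: (svalP q).1.2; exact: ltW.
  have Ep x : inf (E x) <= p x.
    exact: le_trans (Ele _ _ Aq0) ((svalP q0).2 x).
  exists (exist _ (fun x => inf (E x)) (conj sE Ep)) => q Aq.
  by apply/asboolP => x; exact: Ele.
have qodd : forall x, q (- x) = - q x.
  apply: minimal_sublinear_odd => // r sr rq.
  have rp x : r x <= p x by exact: le_trans (rq x) (qp x).
  suff /(congr1 sval) : (exist _ r (conj sr rp) : T) =
    exist _ q (conj sq qp) by [].
  by apply: qmin; apply/asboolP.
have [xi qE] := odd_sublinear_linear sq qodd.
by exists xi => x; rewrite -qE.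
Qed.

(** Every linear minorant xi of [inf_shift p C] works: at - a, with the pair (a, c) itself, the
    bound reads - xi a <= - c. *)
Theorem hahn_banach_cone p (C : set (V * R)) :
  sublinear p -> convex_cone_below p C ->
  exists xi : {linear V -> R^o},
    (forall x, xi x <= p x) /\ forall ac, C ac -> ac.2 <= xi ac.1.
Proof.
move=> sp Cp.
have [xi xiq] := sublinear_linear_minorant (sublinear_inf_shift sp Cp).
exists xi; split=> [x|ac Cac].
  exact: le_trans (xiq x) (inf_shift_le_self x sp Cp).
rewrite -lerN2 -linearN; exact: le_trans (xiq _) (inf_shiftN_le sp Cp Cac).
Qed.

End Sublinear.

(** Subadditivity bounds both p x - p y and p y - p x by K |x - y|. The sign of K is not known, so
    [|K| + 1] serves as a positive divisor. *)
Lemma sublinear_continuous (R : realType) (V : normedModType R) (p : V -> R)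
  (K : R) : sublinear p -> (forall x, p x <= K * `|x|) -> continuous p.
Proof.
move=> sp pK x; apply/cvgrPdist_le => e e0.
have K0 : 0 < `|K| + 1 by rewrite ltr_pwDr.
near=> y.
have yx : `|x - y| <= e / (`|K| + 1).
  by near: y; apply: cvgr_dist_le; [exact: cvg_id|rewrite divr_gt0].
have pe z : `|z| = `|x - y| -> p z <= e.
  move=> zxy; apply: le_trans (pK z) _; rewrite zxy.
  rewrite (@le_trans _ _ ((`|K| + 1) * `|x - y|))//.
    by rewrite ler_wpM2r// (le_trans (ler_norm K))// lerDl.
  by rewrite -ler_pdivlMl// mulrC.
rewrite ler_norml; apply/andP; split.
  by rewrite lerNl opprB (le_trans (sublinearB_le _ _ sp))// pe// distrC.
by rewrite (le_trans (sublinearB_le _ _ sp))// pe.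
Unshelve. all: by end_near. Qed.

(** * The distance to the opposite cone *)

Section DistanceToCone.
Context {R : realType} {Y : normedModType R}.
Variable Theta : set Y.
Hypotheses (Theta_convex : convex_set Theta) (Theta_cone : cone Theta).
Hypothesis Theta0 : Theta 0.

Definition dist_opp_cone : Y -> R :=
  inf_shift (fun y => `|y|) [set (theta, 0) | theta in Theta].

(** The sum is twice the midpoint. *)
Lemma convex_coneD x y : Theta x -> Theta y -> Theta (x + y).
Proof.
move=> Tx Ty.
have half_ge0 : (0 : R) <= 2^-1 by lra.
have half_le1 : (2^-1 : R) <= 1 by lra.
have T2 := Theta_convex (Itv01 half_ge0 half_le1) (mem_set Tx) (mem_set Ty).
have := Theta_cone (ler0n _ 2) (set_mem T2).
rewrite /conv /= /unstable.onem scalerDr !scalerA.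
have -> : 1 - 2^-1 = 2^-1 :> R by lra.
by rewrite divff ?pnatr_eq0// !scale1r.
Qed.

Lemma sublinear_norm : sublinear (fun y : Y => `|y|).
Proof.
split=> [x y|t x t0]; first exact: ler_normD.
by rewrite normrZ ger0_norm.
Qed.

Lemma Theta_below_norm :
  convex_cone_below (fun y => `|y|) [set (theta, 0) | theta in Theta].
Proof.
split.
- by exists 0.
- move=> _ _ [x Tx <-] [y Ty <-] /=; rewrite addr0.
  by exists (x + y) => //; exact: convex_coneD.
- move=> t _ t0 [x Tx <-] /=; rewrite mulr0.
  by exists (t *: x) => //; exact: Theta_cone.
- by move=> _ [x Tx <-] /=.
Qed.

Lemma sublinear_dist : sublinear dist_opp_cone.
Proof. exact: sublinear_inf_shift sublinear_norm Theta_below_norm. Qed.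

Lemma dist_ge0 y : 0 <= dist_opp_cone y.
Proof.
apply: inf_shift_ge => [|_ [x Tx <-] /=]; first exact: Theta_below_norm.
by rewrite subr0.
Qed.

Lemma dist_le_norm y : dist_opp_cone y <= `|y|.
Proof. exact: inf_shift_le_self sublinear_norm Theta_below_norm. Qed.

Lemma distN_cone theta : Theta theta -> dist_opp_cone (- theta) <= 0.
Proof.
move=> Tt; rewrite -[leRHS]oppr0.
by apply: (inf_shiftN_le (ac := (theta, 0)) sublinear_norm Theta_below_norm);
  exists theta.
Qed.

(** Points theta of the cone with |y + theta| < e exist for every e > 0, so - y lies in the closure
    of [Theta]. *)
Lemma dist_eq0 y : closed Theta -> dist_opp_cone y <= 0 -> Theta (- y).
Proof.
move=> Tc dy; apply: Tc => B /nbhs_ballP[e /= e0 Be].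
have [|_ [_ [x Tx <-] <-] /=] :=
    @inf_lt _ [set `|y + ac.1| - ac.2 | ac in [set (x, 0) | x in Theta]] e _
      (le_lt_trans dy e0).
  by exists (`|y + 0| - 0), (0, 0) => //; exists 0.
rewrite subr0 => yxe; exists x; split => //; apply: Be.
by rewrite -ball_normE /= -opprD normrN.
Qed.

End DistanceToCone.

(** * The maximum of the coordinates and the penalty function *)

Section CoordinateMax.
Context {R : realType} {m : nat}.
Variable i0 : 'I_m.
Implicit Types a : 'rV[R]_m.

(** The seed of the iterated maximum is itself an entry, so no default value interferes when all
    entries are negative. *)
Definition vmax a : R := \big[Num.max/a 0 i0]_(i < m) a 0 i.

Lemma vmax_ge a i : a 0 i <= vmax a.
Proof. exact: le_bigmax. Qed.

Lemma vmax_le a t : (forall i, a 0 i <= t) -> vmax a <= t.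
Proof. by move=> at_; apply/bigmax_leP; split => // i _; exact: at_. Qed.

Lemma sublinear_vmax : sublinear vmax.
Proof.
split=> [a b|t a t0]; apply: vmax_le => i; rewrite mxE.
  by rewrite lerD// vmax_ge.
by rewrite ler_wpM2l// vmax_ge.
Qed.

End CoordinateMax.

Lemma coord_le_norm (R : realType) (m n : nat) (A : 'M[R]_(m, n)) i j :
  `|A i j| <= `|A|.
Proof.
rewrite [leRHS]/Num.norm /= mx_normrE.
exact: (le_bigmax _ (fun ij => `|A ij.1 ij.2|) (i, j)).
Qed.

Lemma norm_le_coord (R : realType) (n : nat) (v : 'rV[R]_n) t :
  0 <= t -> (forall j, `|v 0 j| <= t) -> `|v| <= t.
Proof.
move=> t0 vt; rewrite [leLHS]/Num.norm /= mx_normrE; apply/bigmax_leP.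
by split=> // -[i j] _ /=; rewrite (ord1 i).
Qed.

Lemma vmax_le_norm (R : realType) (m : nat) (i0 : 'I_m) (a : 'rV[R]_m) :
  vmax i0 a <= `|a|.
Proof.
by apply: vmax_le => i; apply: le_trans (ler_norm _) (coord_le_norm _ _ _).
Qed.

Section Penalty.
Context {R : realType} {Y : normedModType R} {m : nat}.
Variables (i0 : 'I_m) (Theta : set Y).
Hypotheses (Theta_convex : convex_set Theta) (Theta_cone : cone Theta).
Hypothesis Theta0 : Theta 0.
Variable k : R.
Hypothesis k0 : 0 <= k.

Definition penalty (z : 'rV[R]_m * Y) : R :=
  vmax i0 z.1 + k * dist_opp_cone Theta z.2.

Lemma sublinear_penalty : sublinear penalty.
Proof.
have [vD vZ] := @sublinear_vmax R m i0.
have [dD dZ] := sublinear_dist Theta_convex Theta_cone Theta0.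
split=> [[a y] [b z]|t [a y] t0]; rewrite /penalty /=.
  by rewrite addrACA -mulrDr lerD// ler_wpM2l.
by rewrite mulrDr lerD ?vZ// mulrCA ler_wpM2l ?dZ.
Qed.

(** This linear growth bound is what the first order condition asks of a sublinear function. *)
Lemma penalty_le_norm z : penalty z <= (1 + k) * `|z|.
Proof.
rewrite mulrDl mul1r; apply: lerD.
  by rewrite (le_trans (vmax_le_norm _ _))// prod_normE le_max lexx.
rewrite ler_wpM2l// (le_trans (dist_le_norm _ _ _ _))//.
by rewrite prod_normE le_max lexx orbT.
Qed.

End Penalty.

(** * Scalar product and continuity *)

Lemma dotv_expand (R : realType) (n : nat) (u h : 'rV[R]_n) (t : R) :
  dotv (u + t *: h) (u + t *: h) =
  dotv u u + t * (2 * dotv u h + t * dotv h h).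
Proof.
rewrite /dotv !mulr_sumr -!big_split/= mulr_sumr -big_split/=.
by apply: eq_bigr => j _; rewrite !mxE; ring.
Qed.

Lemma dotvDr (R : realType) (n : nat) (u v w : 'rV[R]_n) :
  dotv u (v + w) = dotv u v + dotv u w.
Proof.
by rewrite /dotv -big_split/=; apply: eq_bigr => j _; rewrite mxE mulrDr.
Qed.

Lemma dotvZr (R : realType) (n : nat) (t : R) (u v : 'rV[R]_n) :
  dotv u (t *: v) = t * dotv u v.
Proof.
by rewrite /dotv mulr_sumr; apply: eq_bigr => j _; rewrite mxE mulrCA.
Qed.

Lemma dotv_eq0 (R : realType) (n : nat) (u : 'rV[R]_n) :
  dotv u u <= 0 -> u = 0.
Proof.
move=> u0; apply/rowP => j; rewrite mxE.
have : dotv u u == 0.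
  by rewrite eq_le u0/=; apply: sumr_ge0 => i _; rewrite -expr2 sqr_ge0.
rewrite psumr_eq0; last by move=> i _; rewrite -expr2 sqr_ge0.
by move=> /allP /(_ j (mem_index_enum _)); rewrite mulf_eq0 orbb => /eqP.
Qed.

Lemma continuousT_comp (T U W : topologicalType) (f : T -> U) (g : U -> W) :
  continuous f -> continuous g -> continuous (g \o f).
Proof. by move=> cf cg x; apply: continuous_comp; [exact: cf|exact: cg]. Qed.

Lemma subr_continuous (R : realType) (V : normedModType R) (a : V) :
  continuous (fun y => y - a).
Proof. by move=> y; apply: cvgB; [exact: cvg_id|exact: cvg_cst]. Qed.

Lemma dotv_sqr_continuous (R : realType) (n : nat) (xb : 'rV[R]_n) :
  continuous (fun x : 'rV[R]_n => dotv (x - xb) (x - xb)).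
Proof.
apply: continuous_big => [|j _ x]; first exact: add_continuous.
have c : (y - xb) 0 j @[y --> x] --> (x - xb) 0 j.
  apply: (@continuous_comp _ _ _ (fun y : 'rV[R]_n => y - xb)
    (fun v : 'rV[R]_n => v 0 j)).
    exact: subr_continuous.
  exact: coord_continuous.
exact: (cvgM c c).
Qed.

(** * First order condition and multipliers for a sublinear function of a differentiable map *)

Section FirstOrder.
Context {R : realType} {n : nat} {V : normedModType R}.
Variables (p : V -> R) (K : R) (G : 'rV[R]_n -> V) (x xb : 'rV[R]_n).
Hypotheses (sp : sublinear p) (pK : forall v, p v <= K * `|v|).
Hypothesis dG : differentiable G x.

(* As p is convex, p (G x + t r) - p (G x) <= t (p (G x + r) - p (G x)) for
   0 < t <= 1; apply this to r = (G (x + t h) - G x) / t, divide by t and let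
   t tend to 0. *)
Lemma first_order_condition :
  (\forall y \near x, p (G x) + dotv (x - xb) (x - xb) <=
                      p (G y) + dotv (y - xb) (y - xb)) ->
  forall h, p (G x) - 2 * dotv (x - xb) h <= p (G x + 'd G x h).
Proof.
move=> xmin h; apply/ler_addgt0Pr => e e0.
have K0 : 0 < `|K| + 1 by rewrite ltr_pwDr.
pose r t := t^-1 *: (G (t *: h + x) - G x).
have rd : r t @[t --> 0^'] --> 'd G x h.
  have dGh : derivable G x h by exact: diff_derivable.
  by rewrite -(deriveE h dG); exact: dGh.
have rdr : r t @[t --> 0^'+] --> 'd G x h.
  move=> A /rd /nbhs_ballP[e' /= e'0 rA]; exists e' => //= t te' t0.
  by apply: rA => //; rewrite gt_eqF.
have hx : t *: h + x @[t --> (0 : R)^'+] --> x.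
  suff : t *: h + x @[t --> (0 : R)^'+] --> 0 *: h + x.
    by rewrite scale0r add0r.
  apply: cvgD; last exact: cvg_cst.
  by apply: cvgZr_tmp; apply: cvg_at_right_filter; exact: cvg_id.
near (0 : R)^'+ => t.
have t0 : 0 < t by near: t; exact: nbhs_right_gt.
have t1 : t <= 1 by near: t; exact: nbhs_right_le.
have mint : p (G x) + dotv (x - xb) (x - xb) <=
    p (G (t *: h + x)) + dotv (t *: h + x - xb) (t *: h + x - xb).
  by near: t; exact: hx xmin.
(* The error e is shared equally: one half for replacing [r t] by the derivative, one half for the
   quadratic term t |h|^2. *)
have rt : `|'d G x h - r t| <= e / 2 / (`|K| + 1).
  by near: t; apply: cvgr_dist_le; rewrite ?divr_gt0.
have th : t * dotv h h <= e / 2.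
  rewrite (@le_trans _ _ (t * (`|dotv h h| + 1)))//.
    by rewrite ler_pM2l// (le_trans (ler_norm _))// lerDl.
  rewrite -ler_pdivlMr ?ltr_pwDr//; near: t; apply: nbhs_right_le.
  by rewrite divr_gt0 ?ltr_pwDr// divr_gt0.
have Grt : G (t *: h + x) = (1 - t) *: G x + t *: (G x + r t).
  rewrite scalerDr addrA -scalerDl subrK scale1r /r scalerA mulfV ?gt_eqF//.
  by rewrite scale1r addrC subrK.
have pr : p (G x + r t) <= p (G x + 'd G x h) + e / 2.
  rewrite -lerBlDl; apply: le_trans (sublinearB_le _ _ sp) _.
  rewrite opprD addrACA subrr add0r; apply: le_trans (pK _) _.
  rewrite distrC in rt.
  rewrite (@le_trans _ _ ((`|K| + 1) * `|r t - 'd G x h|))//.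
    by rewrite ler_wpM2r// (le_trans (ler_norm K))// lerDl.
  by rewrite -ler_pdivlMl// mulrC.
have pG : p (G (t *: h + x)) <= (1 - t) * p (G x) + t * p (G x + r t).
  by rewrite Grt (le_trans (sp.1 _ _))// lerD// sp.2 ?subr_ge0// ltW.
move: mint; rewrite -addrA addrC dotv_expand => mint.
suff : t * (p (G x) - 2 * dotv (x - xb) h) <= t * (p (G x + 'd G x h) + e).
  by rewrite ler_pM2l.
have : t * p (G x + r t) <= t * (p (G x + 'd G x h) + e / 2).
  by rewrite ler_pM2l.
have : t * (t * dotv h h) <= t * (e / 2) by rewrite ler_pM2l.
by nra.
Unshelve. all: by end_near. Qed.

(** Hahn-Banach for the cone spanned by (G x, p (G x)) and the graph of h |-> c h over the
    directions ['d G x h]. The resulting lower bounds on xi are equalities: at G x because xi <= p,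
    along the graph because h may be replaced by - h. *)
Lemma first_order_multiplier :
  (\forall y \near x, p (G x) + dotv (x - xb) (x - xb) <=
                      p (G y) + dotv (y - xb) (y - xb)) ->
  exists xi : {linear V -> R^o},
    [/\ forall v, xi v <= p v, xi (G x) = p (G x) &
        forall h, xi ('d G x h) = - (2 * dotv (x - xb) h)].
Proof.
move=> /first_order_condition foc.
pose c h := - (2 * dotv (x - xb) h).
have cD h1 h2 : c (h1 + h2) = c h1 + c h2 by rewrite /c dotvDr mulrDr opprD.
have cZ t h : c (t *: h) = t * c h by rewrite /c dotvZr mulrN mulrCA.
have c0 : c 0 = 0 by rewrite -(scale0r 0) cZ mul0r.
pose C := [set (sh.1 *: G x + 'd G x sh.2, sh.1 * p (G x) + c sh.2) |
             sh in [set sh : R * 'rV[R]_n | 0 <= sh.1]].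
have Cp : convex_cone_below p C.
  split.
  - by exists (0, 0); rewrite //= scale0r linear0 addr0 mul0r c0 addr0.
  - move=> _ _ [[s h] /= s0 <-] [[t k] /= t0 <-] /=.
    exists (s + t, h + k); first exact: addr_ge0.
    by rewrite /= scalerDl linearD cD mulrDl addrACA [in X in (_, X)]addrACA.
  - move=> t _ t0 [[s h] /= s0 <-] /=.
    exists (t * s, t *: h); first exact: mulr_ge0.
    by rewrite /= scalerDr scalerA linearZ cZ mulrDr mulrA.
  - move=> _ [[s h] /= s0 <-] /=.
    move: s0; rewrite le_eqVlt => /predU1P[<-|s0].
      (* For s = 0, subadditivity lets p (G x) cancel from the first order condition. *)
      rewrite scale0r mul0r !add0r.
      have := foc h; have := sp.1 (G x) ('d G x h); rewrite -/(c h); lra.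
    (* For s > 0, the first order condition in the direction h / s is multiplied by s. *)
    have := foc (s^-1 *: h); rewrite -/(c _) cZ linearZ => foch.
    have sE : s *: G x + 'd G x h = s *: (G x + s^-1 *: 'd G x h).
      by rewrite scalerDr scalerA divff ?gt_eqF// scale1r.
    rewrite sE (sublinearZ _ sp (ltW s0)) -ler_pdivrMl// mulrDr.
    by rewrite mulrA mulVf ?gt_eqF// mul1r.
have [xi [xip xiC]] := hahn_banach_cone sp Cp.
exists xi; split => // [|h].
  apply/eqP; rewrite eq_le xip/=.
  have /xiC /= : C (1 *: G x + 'd G x 0, 1 * p (G x) + c 0).
    by exists (1, 0) => /=.
  by rewrite scale1r linear0 addr0 mul1r c0 addr0.
have xid k : c k <= xi ('d G x k).
  have /xiC /= : C (0 *: G x + 'd G x k, 0 * p (G x) + c k).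
    by exists (0, k) => /=.
  by rewrite scale0r add0r mul0r add0r.
apply/eqP; rewrite eq_le xid andbT -/(c h).
by have := xid (- h); rewrite !linearN -scaleN1r cZ mulN1r lerN2.
Qed.

End FirstOrder.

(** * Local minimizers of the penalized problem near the solution *)

Section PenalizedMinimizer.
Context {R : realType} {n m : nat} {Y : normedModType R}.
Variables (f : 'rV[R]_n -> 'rV[R]_m) (g : 'rV[R]_n -> Y) (Theta : set Y).
Variables (xb : 'rV[R]_n) (i0 : 'I_m).
Hypotheses (f_cont : continuous f) (g_cont : continuous g).
Hypotheses (Theta_closed : closed Theta) (Theta_convex : convex_set Theta).
Hypotheses (Theta_cone : cone Theta) (Theta0 : Theta 0).
Hypothesis xb_opt : local_weak_efficient f (feasible g Theta) xb.

Let G y : 'rV[R]_m * Y := (f y - f xb, g y).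
Let q y : R := dotv (y - xb) (y - xb).

(** The penalized function vanishes at xb, so its minimum over the ball is at most 0 for every k. A
    cluster point of the minimizers is then feasible and must be xb; a minimizer close enough to xb
    is interior to the ball, hence a local minimizer without constraint. *)
Lemma penalized_minimizer (eps : R) : 0 < eps ->
  exists (k : R) (x : 'rV[R]_n),
    [/\ 0 <= k, `|x - xb| < eps, k * dist_opp_cone Theta (g x) < eps &
        \forall y \near x, penalty i0 Theta k (G x) + q x <=
                           penalty i0 Theta k (G y) + q y].
Proof.
move=> eps0.
have [xbF [U [/nbhs_normP[r0 /= r00 r0U] noU]]] := xb_opt.
(* Halving the radius keeps the closed ball inside U. *)
pose r := r0 / 2.
have r_gt0 : 0 < r by rewrite divr_gt0.
pose B := closed_ball_ (fun v : 'rV[R]_n => `|v|) xb r.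
have Bxb : B xb by rewrite /B /closed_ball_ /= subrr normr0 ltW.
have B0 : B !=set0 by exists xb.
have Bcompact : compact B.
  apply: bounded_closed_compact; last exact: closed_closed_ball_.
  exists (`|xb| + r); split=> [|M ltM y By]; first exact: num_real.
  apply: le_trans (ltW ltM); rewrite -{1}(subrK xb y).
  rewrite (le_trans (ler_normD _ _))// addrC lerD2l distrC.
  exact: By.
pose d := dist_opp_cone Theta.
have d_ge0 y : 0 <= d y by exact: dist_ge0.
pose F y : R := vmax i0 (f y - f xb) + q y.
have vmax_cont : continuous (vmax i0 : 'rV[R]_m -> R).
  apply: (@sublinear_continuous _ _ _ 1); first exact: sublinear_vmax.
  by move=> a; rewrite mul1r vmax_le_norm.
have vf_cont : continuous (fun y => vmax i0 (f y - f xb)).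
  have fxb_cont := continuousT_comp f_cont (@subr_continuous _ _ (f xb)).
  exact: continuousT_comp fxb_cont vmax_cont.
have F_cont : continuous (F : 'rV[R]_n -> R).
  by move=> y; exact: (cvgD (vf_cont y) (@dotv_sqr_continuous _ _ xb y)).
have d_cont : continuous (d : Y -> R).
  apply: (@sublinear_continuous _ _ _ 1); first exact: sublinear_dist.
  by move=> y; rewrite mul1r; exact: dist_le_norm.
have dg_cont : continuous ((d \o g) : 'rV[R]_n -> R).
  exact: continuousT_comp g_cont d_cont.
have Fxb : F xb = 0.
  rewrite /F /q !subrr /dotv (sublinear0 (sublinear_vmax _)) add0r.
  by rewrite big1// => j _; rewrite mxE mul0r.
have dgxb : d (g xb) = 0.
  apply/eqP; rewrite eq_le d_ge0 andbT.
  by case: xbF => theta Ttheta <-; exact: distN_cone.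
have min_ex (k : nat) : exists x, B x /\
    forall y, B y -> F x + k%:R * d (g x) <= F y + k%:R * d (g y).
  have [|x /set_mem Bx xmin] :=
      @EVT_min_rV R n (fun y => F y + k%:R * d (g y)) B B0 Bcompact.
    apply: continuous_subspaceT => y.
    exact: (cvgD (F_cont y) (cvgM (cvg_cst _) (dg_cont y))).
  by exists x; split => // y By; apply: xmin; rewrite inE.
have [xs xsP] := choice min_ex.
have xsB k : B (xs k) by case: (xsP k).
have xs_le0 k : F (xs k) + k%:R * d (g (xs k)) <= 0.
  by have [_ /(_ xb Bxb)] := xsP k; rewrite Fxb dgxb mulr0 addr0.
have kd_ge0 (k : nat) : 0 <= k%:R * d (g (xs k)) by rewrite mulr_ge0.
(* The minimum F c on the ball bounds every k d (g x_k) by - F c, uniformly in k. *)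
have [c _ cmin] : exists2 c, c \in B & forall y, y \in B -> F c <= F y.
  by apply: EVT_min_rV => //; exact: continuous_subspaceT.
have [|xl [Bxl xl_cluster]] := Bcompact (xs @ \oo) _.
  by exists 0%N => // k _ /=; exact: xsB.
(* This use of clustering avoids extracting a subsequence: a property near xl and one of all large k
   hold together for some k. *)
have frequently (P : set 'rV[R]_n) (Q : set nat) : nbhs xl P ->
    (\forall k \near \oo, Q k) -> exists k, P (xs k) /\ Q k.
  move=> nP [N _ NQ].
  have [|_ [[k Nk <-] Pk]] := xl_cluster [set xs k | k in Q] P _ nP.
    by exists N => // k Nk; exists k => //; exact: NQ.
  by exists k.
have Fxl : F xl <= 0.
  rewrite leNgt; apply/negP => Fxl.
  have [k [Fk _]] : exists k, 0 < F (xs k) /\ True.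
    apply: (frequently [set y | 0 < F y] setT); last exact: nearW.
    exact: (cvgr_gt _ (F_cont xl)).
  have := xs_le0 k; have := kd_ge0 k; lra.
(* Were d (g xl) positive, d (g x_k) would exceed half of it for some k so large that k d (g x_k) >
   - F c. *)
have dgxl : d (g xl) <= 0.
  rewrite leNgt; apply/negP => dpos.
  have [k [dk Mk]] : exists k, d (g xl) / 2 < d (g (xs k)) /\
      - F c / (d (g xl) / 2) < k%:R.
    apply: (frequently [set y | d (g xl) / 2 < d (g y)]).
      by apply: (cvgr_gt _ (dg_cont xl)); rewrite /=; lra.
    exact: nbhs_infty_gtr.
  move: Mk; rewrite ltr_pdivrMr ?divr_gt0// => Mk.
  have : k%:R * (d (g xl) / 2) <= k%:R * d (g (xs k)).
    by rewrite ler_wpM2l// ltW.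
  have := xs_le0 k; have := cmin _ (mem_set (xsB k)); lra.
have xlE : xl = xb.
  apply/eqP; rewrite -subr_eq0; apply/eqP/dotv_eq0.
  (* Here xl is feasible and lies in U, so a negative maximum would contradict weak efficiency; what
     remains of F xl <= 0 is |xl - xb|^2 <= 0. *)
  suff : 0 <= vmax i0 (f xl - f xb) by move: Fxl; rewrite /F /q; lra.
  rewrite leNgt; apply/negP => vneg; apply: noU; exists xl; split.
    split.
      apply: r0U => /=; apply: le_lt_trans Bxl _.
      by rewrite /r ltr_pdivrMr// ltr_pMr// ltr1n.
    by exists (- g xl); [exact: dist_eq0|rewrite opprK].
  move=> i; rewrite -subr_lt0; apply: le_lt_trans vneg.
  by have := vmax_ge i0 (f xl - f xb) i; rewrite !mxE.
(* The bound by r makes x_k interior to the ball, and - eps < F x_k turns F x_k + k d (g x_k) <= 0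
   into k d (g x_k) < eps. *)
have [k [[xk_eps xk_r Fk] _]] : exists k,
    [/\ `|xs k - xb| < eps, `|xs k - xb| < r & - eps < F (xs k)] /\ True.
  apply: (frequently
    [set y | [/\ `|y - xb| < eps, `|y - xb| < r & - eps < F y]] setT);
    last exact: nearW.
  rewrite xlE; near=> y; split.
  - near: y; apply: cvgr_distC_lt => //; exact: cvg_id.
  - near: y; apply: cvgr_distC_lt => //; exact: cvg_id.
  - by near: y; apply: (cvgr_gt _ (F_cont xb)); rewrite Fxb oppr_lt0.
exists k%:R, (xs k); split => //.
  have := xs_le0 k; rewrite -/d; lra.
near=> y.
have By : B y.
  rewrite /B /closed_ball_ /= ltW// distrC; near: y.
  have norm_sub_cont :=
    continuousT_comp (@subr_continuous _ _ xb) (@norm_continuous _ _).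
  exact: (cvgr_lt _ (norm_sub_cont (xs k))).
have [_ /(_ y By)] := xsP k.
by rewrite /penalty /F /= -/d addrAC => ykmin; rewrite [leRHS]addrAC.
Unshelve. all: by end_near. Qed.

End PenalizedMinimizer.

(** * Multipliers at a penalized minimizer *)

Lemma vmax_multiplier (R : realType) (m : nat) (i0 : 'I_m)
  (phi : {linear 'rV[R]_m -> R^o}) : (forall a, phi a <= vmax i0 a) ->
  (forall i, 0 <= riesz phi 0 i) /\ \sum_i riesz phi 0 i = 1.
Proof.
(* The tests are - e_i and the constant vectors 1 and - 1, where the maximum is at most 0, 1 and -
   1. *)
move=> phiv; split=> [i|].
  rewrite mxE -oppr_le0 -linearN; apply: le_trans (phiv _) _.
  by apply: vmax_le => j; rewrite !mxE oppr_le0 ler0n.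
have -> : \sum_i riesz phi 0 i = phi (const_mx 1).
  rewrite -((rieszP phi (riesz phi)).2 erefl) /dotv.
  by apply: eq_bigr => i _; rewrite [const_mx 1 _ _]mxE mulr1.
apply/eqP; rewrite eq_le; apply/andP; split.
  by apply: le_trans (phiv _) _; apply: vmax_le => j; rewrite mxE.
rewrite -lerN2 -linearN; apply: le_trans (phiv _) _.
by apply: vmax_le => j; rewrite !mxE.
Qed.

Lemma diff_subr_cst (R : realType) (V W : normedModType R) (f : V -> W) x a h :
  differentiable f x -> 'd (fun y => f y - a) x h = 'd f x h.
Proof.
move=> df.
have dc : differentiable (cst a : V -> W) x by exact: differentiable_cst.
transitivity ('d f x h - 'd (cst a : V -> W) x h).
  exact: (congr1 (@^~ h) (diffB df dc)).
have -> : 'd (cst a : V -> W) x h = 0 by exact: (congr1 (@^~ h) (diff_cst a x)).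
exact: subr0.
Qed.

Section ApproximateMultipliers.
Context {R : realType} {n m : nat} {Y : normedModType R}.
Variables (f : 'rV[R]_n -> 'rV[R]_m) (g : 'rV[R]_n -> Y) (Theta : set Y).
Variables (xb : 'rV[R]_n) (i0 : 'I_m).
Hypotheses (df : forall x, differentiable f x).
Hypotheses (dg : forall x, differentiable g x).
Hypotheses (Theta_closed : closed Theta) (Theta_convex : convex_set Theta).
Hypotheses (Theta_cone : cone Theta) (Theta0 : Theta 0).
Hypothesis xb_opt : local_weak_efficient f (feasible g Theta) xb.

(** The functional xi on the product splits into its restrictions phi <= vmax and mu <= k d. The
    first gives a point of the simplex; the second makes mu continuous, as k d is at most k times
    the norm, and nonnegative on [Theta], as d vanishes on - [Theta]. *)
Lemma approximate_multipliers (eps : R) : 0 < eps ->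
  exists (x : 'rV[R]_n) (lambda : 'rV[R]_m) (mu : {linear Y -> R^o}),
    [/\ `|x - xb| < eps,
        (forall i, 0 <= lambda 0 i) /\ \sum_i lambda 0 i = 1,
        dual_cone Theta mu,
        forall h, dotv lambda ('d f x h) + mu ('d g x h) =
                  - (2 * dotv (x - xb) h) &
        `|mu (g x)| < eps].
Proof.
move=> eps0.
have f_cont : continuous f by move=> x; exact: differentiable_continuous.
have g_cont : continuous g by move=> x; exact: differentiable_continuous.
have [k [x [k0 x_eps kd_eps xmin]]] :=
  penalized_minimizer i0 f_cont g_cont Theta_closed Theta_convex Theta_cone
    Theta0 xb_opt eps0.
pose d := dist_opp_cone Theta.
pose p : 'rV[R]_m * Y -> R := penalty i0 Theta k.
pose f' y := f y - f xb.
pose G y : 'rV[R]_m * Y := (f' y, g y).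
have sp : sublinear p by exact: sublinear_penalty.
have df' : differentiable f' x.
  by apply: differentiableB => //; exact: differentiable_cst.
have dG : differentiable G x by exact: differentiable_pair.
have dGE h : 'd G x h = ('d f x h, 'd g x h).
  transitivity ('d f' x h, 'd g x h).
    exact: (congr1 (@^~ h) (diff_pair df' (dg x))).
  have df'E := diff_subr_cst (f xb) h (df x).
  exact: (congr1 (fun v => (v, 'd g x h)) df'E).
have [xi [xip xiG xid]] := first_order_multiplier sp
  (penalty_le_norm i0 Theta_convex Theta_cone Theta0 k0) dG xmin.
have phi_lin : linear (fun a => xi (a, 0) : R^o).
  move=> t a b; rewrite -linearP; congr (xi (_, _)).
  by rewrite /= scaler0 addr0.
have mu_lin : linear (fun y => xi (0, y) : R^o).
  move=> t y z; rewrite -linearP; congr (xi (_, _)).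
  by rewrite /= scaler0 addr0.
pose phi : {linear 'rV[R]_m -> R^o} := HB.pack (fun a => xi (a, 0) : R^o)
  (GRing.isLinear.Build _ _ _ _ _ phi_lin).
pose mu : {linear Y -> R^o} := HB.pack (fun y => xi (0, y) : R^o)
  (GRing.isLinear.Build _ _ _ _ _ mu_lin).
have xiE a y : xi (a, y) = phi a + mu y.
  rewrite /phi /mu /= -linearD; congr (xi (_, _)); first by rewrite /= addr0.
  by rewrite /= add0r.
have d0 : d 0 = 0 by apply: sublinear0; exact: sublinear_dist.
have phi_le a : phi a <= vmax i0 a.
  have := xip (a, 0); rewrite /p /penalty /= -/d d0 mulr0 addr0; exact.
have mu_le y : mu y <= k * d y.
  have := xip (0, y).
  by rewrite /p /penalty /= -/d (sublinear0 (sublinear_vmax i0)) add0r; exact.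
(* Each part of xi is at most its part of the penalty and the totals agree at G x, so both bounds
   are attained. *)
have muG : mu (g x) = k * d (g x).
  apply/eqP; rewrite eq_le mu_le/=.
  have := xiG; have := phi_le (f' x).
  rewrite /G xiE /p /penalty /= -/d; lra.
have [lambda_ge0 lambda_sum] := vmax_multiplier phi_le.
exists x, (riesz phi), mu; split => //.
- split=> [|theta Ttheta].
    apply: (@sublinear_continuous _ _ _ k).
      by split=> [y z|t y _]; rewrite ?linearD ?linearZ.
    move=> y; apply: le_trans (mu_le y) _; rewrite ler_wpM2l//.
    exact: dist_le_norm.
  rewrite -oppr_le0 -linearN; apply: le_trans (mu_le _) _.
  by rewrite mulr_ge0_le0//; exact: distN_cone.
- by move=> h; rewrite ((rieszP phi (riesz phi)).2 erefl) -xiE -dGE.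
- by rewrite muG ger0_norm// mulr_ge0//; exact: dist_ge0.
Qed.

End ApproximateMultipliers.

(** * Passage to the limit *)

Lemma diff_coord (R : realType) (n m : nat) (f : 'rV[R]_n -> 'rV[R]_m) x i h :
  differentiable f x ->
  'd (fun z => f z 0 i : R^o) x h = 'd f x h 0 i.
Proof.
move=> df.
have coord_lin : linear (fun v : 'rV[R]_m => v 0 i : R^o).
  by move=> t u v; rewrite !mxE.
pose coord : {linear 'rV[R]_m -> R^o} :=
  HB.pack (fun v : 'rV[R]_m => v 0 i : R^o)
    (GRing.isLinear.Build _ _ _ _ _ coord_lin).
have coord_cont : continuous coord by exact: coord_continuous.
rewrite (_ : (fun z => _) = coord \o f)// diff_comp//; last first.
  exact: linear_differentiable.
by rewrite diff_lin.
Qed.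

Lemma cvg_diff (R : realType) (V W : normedModType R) (f : V -> W)
  (u : nat -> V) x h : continuously_differentiable f ->
  u k @[k --> \oo] --> x -> 'd f (u k) h @[k --> \oo] --> 'd f x h.
Proof.
move=> [_ cdf] ux; apply/cvgrPdistC_le => e e0.
have h0 : 0 < `|h| + 1 by rewrite ltr_pwDr.
have e'0 : 0 < e / (`|h| + 1) by rewrite divr_gt0.
have dfu : \forall k \near \oo, forall v,
    `|'d f (u k) v - 'd f x v| <= e / (`|h| + 1) * `|v|.
  exact: ux _ (cdf x _ e'0).
near=> k.
rewrite (@le_trans _ _ (e / (`|h| + 1) * `|h|))//.
  by near: k; apply: filterS dfu => k; exact.
by rewrite mulrAC ler_pdivrMr// ler_pM2l// lerDl.
Unshelve. all: by end_near. Qed.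

Lemma cvg_rV_coord (R : realType) (n : nat) (u : nat -> 'rV[R]_n)
  (a : 'rV[R]_n) :
  (forall j, u k 0 j @[k --> \oo] --> a 0 j) -> u k @[k --> \oo] --> a.
Proof.
move=> ua; apply/cvgrPdist_le => e e0.
have : \forall k \near \oo, forall j, `|a 0 j - u k 0 j| <= e.
  by apply: filter_forall => j; exact: (@cvgr_dist_le _ R^o _ _ _ _ _ (ua j)).
apply: filterS => k uk; apply: norm_le_coord; first exact: ltW.
by move=> j; rewrite !mxE.
Qed.

Lemma cvg_harmonic_bound (R : realType) (V : normedModType R) (u : nat -> V)
  (a : V) : (forall k, `|u k - a| < k.+1%:R^-1) -> u k @[k --> \oo] --> a.
Proof.
move=> ua; apply/cvgrPdistC_lt => e e0.
near=> k; apply: lt_le_trans (ua k) _; near: k.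
exact: (cvgr_le _ (@cvg_harmonic R)).
Unshelve. all: by end_near. Qed.

(** s k is chosen beyond k with u (s k) within 1 / (k + 1) of a cluster point. Monotonicity of s is
    not claimed: k <= s k is enough to carry over the bounds 1 / (k + 1). *)
Lemma compact_cvg_subsequence (R : realType) (V : normedModType R) (A : set V)
  (u : nat -> V) : compact A -> (forall k, A (u k)) ->
  exists (s : nat -> nat) (a : V),
    [/\ A a, forall k, (k <= s k)%N & u (s k) @[k --> \oo] --> a].
Proof.
move=> cA uA; have [|a [Aa acl]] := cA (u @ \oo) _.
  by exists 0%N => // k _; exact: uA.
have sub k : exists l, (k <= l)%N /\ `|u l - a| < k.+1%:R^-1.
  have [||_ [[l kl <-] ual]] :=
      acl [set u l | l in [set l | (k <= l)%N]] [set v | `|v - a| < k.+1%:R^-1].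
  - by exists k => // l kl; exists l.
  - by apply: cvgr_distC_lt; [exact: cvg_id|rewrite invr_gt0].
  by exists l.
have [s sP] := choice sub.
exists s, a; split=> // [k|]; first by case: (sP k).
by apply: cvg_harmonic_bound => k; case: (sP k).
Qed.

Theorem theorem3p3 (R : realType) (n m : nat) (n_ge1 : (1 <= n)%N)
  (m_ge1 : (1 <= m)%N) (Y : completeNormedModType R)
  (f : 'rV[R]_n -> 'rV[R]_m) (g : 'rV[R]_n -> Y) (Theta : set Y)
  (xbar : 'rV[R]_n)
  (f_C1 : continuously_differentiable f)
  (g_C1 : continuously_differentiable g)
  (Theta_closed : closed Theta)
  (Theta_convex : convex_set Theta)
  (Theta_cone : cone Theta) :
  local_weak_efficient f (feasible g Theta) xbar -> AKKT f g Theta xbar.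
Proof.
move=> xopt; have [xF _] := xopt.
split=> //.
(* Feasibility of [xbar] supplies a point of the cone, and scaling it by 0 gives the origin. *)
have Theta0 : Theta 0.
  by case: xF => theta Ttheta _; rewrite -(scale0r theta); exact: Theta_cone.
have inv_gt0 (k : nat) : (0 : R) < k.+1%:R^-1 by rewrite invr_gt0.
have approx (k : nat) := approximate_multipliers (Ordinal m_ge1) f_C1.1 g_C1.1
  Theta_closed Theta_convex Theta_cone Theta0 xopt (inv_gt0 k).
have [xs /choice[la /choice[mu xlamuP]]] := choice approx.
(* The simplex sits in the compact cube [0, 1]^m; the sum of the limit is recovered afterwards by
   continuity. *)
pose S := [set v : 'rV[R]_m | forall i, `[0, 1]%classic (v ord0 i)].
have laS k : S (la k).
  move=> i; have [_ [la0 la1] _ _ _] := xlamuP k.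
  rewrite /= in_itv/= la0 -la1 (bigD1 i)//= lerDl.
  by apply: sumr_ge0 => j _; exact: la0.
have [|s [lambda [lambdaS s_ge la_cvg]]] :=
    compact_cvg_subsequence (A := S) (u := la) _ laS.
  exact: (@rV_compact R m (fun=> `[0, 1]%classic)
    (fun=> @segment_compact R 0 1)).
have inv_le k : (s k).+1%:R^-1 <= k.+1%:R^-1 :> R.
  by rewrite lef_pV2 ?posrE// ler_nat ltnS.
have x_cvg : xs (s k) @[k --> \oo] --> xbar.
  apply: cvg_harmonic_bound => k; apply: lt_le_trans (inv_le k).
  by case: (xlamuP (s k)).
have la_coord i : la (s k) 0 i @[k --> \oo] --> lambda 0 i.
  exact: (cvg_comp _ _ la_cvg (@coord_continuous _ _ _ 0 i lambda)).
exists lambda, (xs \o s), (mu \o s); split=> //=.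
- split=> [i|]; first by have /andP[] := lambdaS i.
  have sum_cvg : \sum_i la (s k) 0 i @[k --> \oo] --> \sum_i lambda 0 i.
    by apply: cvg_big => [|i _]; [exact: add_continuous|exact: la_coord].
  apply: (@norm_cvg_unique _ R^o _ _ _ _ sum_cvg).
  rewrite (_ : (fun k => _) = cst 1); first exact: cvg_cst.
  by apply/funext => k; case: (xlamuP (s k)) => _ [].
- by move=> k; case: (xlamuP (s k)).
- apply: cvg_rV_coord => j; rewrite mxE.
  pose e : 'rV[R]_n := delta_mx 0 j.
  pose D x i : R := ('d f x e) 0 i.
  have gradE (lam : 'rV[R]_m) :
      (\sum_i lam 0 i *: gradient (fun z => f z 0 i) xbar) 0 j =
      \sum_i lam 0 i * D xbar i.
    rewrite summxE; apply: eq_bigr => i _; rewrite !mxE diff_coord//.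
    exact: f_C1.1.
  (* Stationarity is exact for [la (s k)] and the derivative of f at x_(s k). The residual is thus
     the derivative of the quadratic term plus the error of putting the limit [lambda] and the point
     [xbar] instead; both vanish in the limit. *)
  pose r k := - (2 * (xs (s k) - xbar) 0 j) +
      \sum_i (lambda 0 i * D xbar i - la (s k) 0 i * D (xs (s k)) i).
  have residualE k : (adjoint ('d g (xs (s k))) (mu (s k)) +
      \sum_i lambda 0 i *: gradient (fun z => f z 0 i) xbar) 0 j = r k.
    rewrite mxE gradE /r sumrB [X in X + _]mxE /=.
    have [_ _ _ /(_ e) kkt _] := xlamuP (s k).
    have -> : (xs (s k) - xbar) 0 j = dotv (xs (s k) - xbar) e.
      rewrite /dotv (bigD1 j)//= /e [delta_mx _ _ _ _]mxE !eqxx mulr1.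
      rewrite big1 ?addr0// => i ij.
      by rewrite [delta_mx _ _ _ _]mxE (negbTE ij) andbF mulr0.
    have sumE (a b c d : R) : b + a = d -> a + c = d + (c - b).
      by move=> <-; ring.
    exact: sumE kkt.
  rewrite (funext residualE).
  have D_cvg i : D (xs (s k)) i @[k --> \oo] --> D xbar i.
    have df_cvg := cvg_diff (h := e) f_C1 x_cvg.
    exact: (cvg_comp _ _ df_cvg (@coord_continuous R _ _ 0 i ('d f xbar e))).
  have x_coord : (xs (s k) - xbar) 0 j @[k --> \oo] --> (xbar - xbar) 0 j.
    have sub_cvg := cvg_comp _ _ x_cvg (@subr_continuous _ _ xbar xbar).
    exact: (cvg_comp _ _ sub_cvg (@coord_continuous _ _ _ 0 j _)).
  have r_cvg : r k @[k --> \oo] --> - (2 * (xbar - xbar) 0 j) +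
      \sum_i (lambda 0 i * D xbar i - lambda 0 i * D xbar i).
    apply: cvgD; first by apply: cvgN; apply: cvgM; [exact: cvg_cst|].
    apply: cvg_big => [|i _]; first exact: add_continuous.
    by apply: cvgB; [exact: cvg_cst|apply: cvgM; [exact: la_coord|]].
  move: r_cvg; rewrite subrr mxE mulr0 oppr0 add0r big1// => i _.
  exact: subrr.
- apply: (@cvg_harmonic_bound _ R^o) => k; rewrite subr0.
  by apply: lt_le_trans (inv_le k); case: (xlamuP (s k)).
Qed.
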